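(* There exist two frequently hypercyclic weighted backward shifts $B_w,B_{w'}$ on $c_0(\mathbb Z_+)$ such that $B_w\oplus B_{w'}$ is not $\mathcal U$-frequently hypercyclic on $c_0(\mathbb Z_+)\oplus c_0(\mathbb Z_+)$.
   Context: For a bounded weight sequence $w=(w_n)_{n\ge1}$, the weighted backward shift is $B_we_0=0$, $B_we_n=w_ne_{n-1}$ ($n\ge1$), where $(e_k)$ is the canonical basis. $\mathcal N_T(x,V):=\{n\in\mathbb N:T^nx\in V\}$. $T$ is frequently hypercyclic (resp. $\mathcal U$-frequently hypercyclic) if there is $x$ such that $\mathcal N_T(x,V)$ has positive lower density (resp. positive upper density) for every non-empty open $V$. *)

(* Defs.v *)
From HB Require Import structures.
From mathcomp Require Import all_boot all_order all_algebra.
From mathcomp Require Import boolp classical_sets reals topology normedtype sequences.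
Set Implicit Arguments. Unset Strict Implicit. Unset Printing Implicit Defensive.
Import Order.TTheory GRing.Theory Num.Theory numFieldNormedType.Exports.
Local Open Scope ring_scope.
Local Open Scope classical_set_scope.

Section Defs.
Variable R : realType.

Definition c0 (x : nat -> R) : Prop := x @ \oo --> (0 : R).

(* sup-norm distance ||x - y||_oo < eps *)
Definition sup_close (x y : nat -> R) (eps : R) : Prop :=
  exists r : R, r < eps /\ forall n, `|x n - y n| <= r.

Definition c0_open (V : set (nat -> R)) : Prop :=
  forall x, c0 x -> V x ->
    exists2 eps : R, 0 < eps &
      forall y, c0 y -> sup_close x y eps -> V y.

Definition c0_open2 (V : set ((nat -> R) * (nat -> R))) : Prop :=
  forall x x', c0 x -> c0 x' -> V (x, x') ->
    exists2 eps : R, 0 < eps &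
      forall y y', c0 y -> c0 y' -> sup_close x y eps -> sup_close x' y' eps ->
        V (y, y').

Definition bounded_weight (w : nat -> R) : Prop := exists M : R, forall n, `|w n| <= M.

(* weighted backward shift: B_w e_0 = 0, B_w e_n = w_n e_{n-1};
   i.e. (B_w x)_k = w_{k+1} x_{k+1} *)
Definition bshift (w : nat -> R) (x : nat -> R) : nat -> R :=
  fun k => w k.+1 * x k.+1.

End Defs.

Definition count_upto (A : set nat) (n : nat) : nat :=
  \sum_(i < n.+1) (`[< A i >] : nat).

Definition pos_lower_density (R : realType) (A : set nat) : Prop :=
  exists2 d : R, 0 < d &
    exists N, forall n, (N <= n)%N -> d * (n.+1)%:R <= (count_upto A n)%:R.

Definition pos_upper_density (R : realType) (A : set nat) : Prop :=
  exists2 d : R, 0 < d &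
    forall N, exists2 n, (N <= n)%N & d * (n.+1)%:R <= (count_upto A n)%:R.

Definition return_set {X : Type} (T : X -> X) (x : X) (V : set X) : set nat :=
  [set n | V (iter n T x)].

Definition freq_hypercyclic (R : realType) (T : (nat -> R) -> (nat -> R)) : Prop :=
  exists2 x, c0 x &
    forall V, c0_open V -> (exists2 y, c0 y & V y) ->
      pos_lower_density R (return_set T x V).

Definition ufreq_hypercyclic2 (R : realType) (T T' : (nat -> R) -> (nat -> R)) : Prop :=
  exists x x', [/\ c0 x, c0 x' &
    forall V, c0_open2 V -> (exists y y', [/\ c0 y, c0 y' & V (y, y')]) ->
      pos_upper_density R (return_set (fun p => (T p.1, T' p.2)) (x, x') V)].

(* Main.v *)
(** With [W_n = w_1 ... w_n], the vector [x_m = y_m / W_m] satisfies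
    [(B_w^n x)_k = y_{n+k} / W_k]. Hence placing copies of a target at the times of
    sets [E_p] gives a frequently hypercyclic vector as soon as [W] is large on the
    differences [E_q - E_p] and tends to infinity along each [E_p].

    Here [E_p] is the union, over the blocks [[10^j, 2 10^j)] with [j = 2k + e] and
    [logn 2 k = p], of the progression of step [period p] starting at [10^j]. A difference of two
    visits is then either a multiple of [period p], on which a height depending only
    on [p] suffices, or comparable to some [10^j] with [j = e] modulo 2. Taking
    [e = 0] for [w] and [e = 1] for [w'] separates the scales: [W] and [W'] can only be
    simultaneously large close to multiples of [period p] with [p] large, a set of
    small upper density. But visits of [B_w (+) B_w'] to
    [{|y_0| > 1, |y'_0| > 1}] force [W_n] and [W'_n] to infinity. *)

Require Import Defs.
From mathcomp Require Import all_boot all_order all_algebra.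
From mathcomp Require Import boolp classical_sets reals.
From mathcomp Require Import topology normedtype sequences.
From mathcomp Require Import zify ring lra.
Set Implicit Arguments. Unset Strict Implicit. Unset Printing Implicit Defensive.
Import Order.TTheory GRing.Theory Num.Theory numFieldNormedType.Exports.

(** * Scales, periods and the height function *)

Definition scale (e k : nat) : nat := 10 ^ (2 * k + e).

(** Windows of length [4 * p] around the multiples fill a proportion of order [2 ^- p], which is
    summable; the factor [8 * p.+1] leaves room for them. *)
Definition period (p : nat) : nat := 8 * p.+1 * 2 ^ p.

(* [v] is a lower bound imposed on [log_2 W_m]. *)
Definition required (e m v : nat) : Prop :=
  (exists k, [/\ 0 < k, scale e k <= 2 * m, m <= 3 * scale e k & v = 4 * k]) \/
  (exists p i, [/\ 0 < i, i * period p <= m, m < i * period p + p & v = 3 * p]).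

Definition forced (e n c : nat) : Prop :=
  exists m v, [/\ n <= m, required e m v & c + (m - n) <= v].

(* The least function above all requirements that grows by at most one per step, so
   that the weights [2 ^ (height n - height n.-1)] are bounded. *)
Definition height (e n : nat) : nat := \max_(c < n.+1 | `[< forced e n c >]) c.

Lemma scaleS e k : scale e k.+1 = 100 * scale e k.
Proof. by rewrite /scale mulnS -addnA expnD. Qed.

Lemma leq_scale e k l : k <= l -> scale e k <= scale e l.
Proof. by move=> kl; rewrite leq_exp2l // leq_add2r leq_mul2l. Qed.

Lemma scale_lt e k l : k < l -> 100 * scale e k <= scale e l.
Proof. by rewrite -scaleS; exact: leq_scale. Qed.

Lemma scale_gt e k : 0 < k -> 80 * k <= scale e k.
Proof.
case: k => // k _; elim: k => [|k IH].
  by rewrite /scale (@leq_trans (10 ^ 2)) // leq_exp2l.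
by rewrite scaleS; lia.
Qed.

Lemma period_gt p : 8 * p.+1 <= period p.
Proof. by rewrite /period leq_pmulr // expn_gt0. Qed.

(** Forced values at [n] are thus at most [n], so the range [c < n.+1] in [height] cuts off
    nothing. *)
Lemma required_le e m v : required e m v -> v <= m.
Proof.
case=> [[k [k0 km _ ->]]|[p [[|i] [//i0 im _ ->]]]].
  by have := scale_gt e k0; lia.
by have := period_gt p; rewrite mulSn in im; lia.
Qed.

Lemma forced_le_height e n c : forced e n c -> c <= height e n.
Proof.
move=> fc; have cn : c < n.+1.
  by case: fc => m [v [nm /required_le vm cv]]; lia.
by rewrite /height (bigD1 (Ordinal cn)) ?leq_maxl //=; exact/asboolP.
Qed.

Lemma required_le_height e m v : required e m v -> v <= height e m.
Proof. by move=> rv; apply: forced_le_height; exists m, v; rewrite subnn addn0. Qed.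

Lemma height_forced e n : 0 < height e n -> forced e n (height e n).
Proof.
rewrite /height; elim/big_ind: _ => [//|a b ha hb|c /asboolP//].
by case: (leqP a b).
Qed.

Lemma heightS e n : height e n.+1 <= (height e n).+1.
Proof.
case: (posnP (height e n.+1)) => [->//|h0].
have [m [v [nm rv hv]]] := height_forced h0.
rewrite -ltnS -[X in X < _]prednK// !ltnS; apply: forced_le_height.
by exists m, v; split; [lia| |lia].
Qed.

Lemma height0 e : height e 0 = 0.
Proof. by rewrite /height big_mkcond big_ord1; case: ifP. Qed.

Lemma height_le e n : height e n <= n.
Proof. by elim: n => [|n IH]; [rewrite height0|have := heightS e n; lia]. Qed.

(** * Times at which both heights are large *)

Definition near_period (p n : nat) : Prop :=
  exists i, [/\ 0 < i, i * period p <= n + 3 * p & n < i * period p + p].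

(** With unit slope, a requirement [v] acts at most [v] steps to the left, so the windows grow by
    [4 * k] or [3 * p] on that side only. *)
Lemma forced_near e n c : forced e n c ->
  (exists k, [/\ 0 < k, scale e k <= 2 * n + 8 * k & n <= 3 * scale e k]) \/
  (exists2 p, c <= 3 * p & near_period p n).
Proof.
case=> m [v [nm [[k [k0 km mk ->]]|[p [i [i0 im mi ->]]]] cv]]; [left|right].
  by exists k; split => //; lia.
by exists p; [lia|exists i; split => //; lia].
Qed.

Lemma scale_gap e e' k k' n : 2 * k + e < 2 * k' + e' -> 0 < k' ->
  n <= 3 * scale e k -> scale e' k' <= 2 * n + 8 * k' -> False.
Proof.
move=> lt_kk' k'0 nk kn; have := scale_gt e' k'0.
have: 10 * scale e k <= scale e' k' by rewrite -expnS leq_exp2l.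
by have: 0 < scale e k by [rewrite expn_gt0]; lia.
Qed.

(** The exponents [2 * k] and [2 * l + 1] never agree, so block windows of the two heights are
    disjoint by [scale_gap]; one of the heights must come from a period. *)
Lemma common_height n c : 0 < c -> c <= height 0 n -> c <= height 1 n ->
  exists2 p, c <= 3 * p & near_period p n.
Proof.
move=> c0 h0 h1.
have [|[k [k0 kn nk]]|[p cp np]] := @forced_near 0 n (height 0 n).
- by apply: height_forced; lia.
- have [|[l [l0 ln nl]]|[p cp np]] := @forced_near 1 n (height 1 n).
  + by apply: height_forced; lia.
  + exfalso; case: (ltnP (2 * k + 0) (2 * l + 1)) => kl.
      exact: (scale_gap kl l0 nk ln).
    by apply: (@scale_gap 1 0 l k n) => //; move: kl; lia.
  + by exists p => //; lia.
- by exists p => //; lia.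
Qed.

(** * Counting the times of common large height *)

Lemma count_uptoE (A : set nat) n :
  count_upto A n = size [seq i <- iota 0 n.+1 | `[< A i >]].
Proof.
rewrite /count_upto size_filter -sum1_count -(big_mkord xpredT (fun i => `[< A i >] : nat)).
by rewrite /index_iota subn0 [RHS]big_mkcond; apply: eq_bigr => i _; case: asbool.
Qed.

Lemma count_upto_ge (A : set nat) n s : uniq s ->
  (forall i, i \in s -> i <= n /\ A i) -> size s <= count_upto A n.
Proof.
move=> us sA; rewrite count_uptoE; apply: uniq_leq_size => // i /sA[le_in Ai].
by rewrite mem_filter mem_iota/= add0n ltnS le_in andbT; exact/asboolP.
Qed.

Lemma count_upto_le (A : set nat) n s :
  (forall i, i <= n -> A i -> i \in s) -> count_upto A n <= size s.
Proof.
move=> As; rewrite count_uptoE; apply: uniq_leq_size.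
  by rewrite filter_uniq ?iota_uniq.
by move=> i; rewrite mem_filter mem_iota => /andP[/asboolP Ai]; rewrite /= ltnS => /As; apply.
Qed.

Definition near_period_list (n p : nat) : seq nat :=
  [seq i * period p + s - 3 * p | i <- iota 1 ((n + 3 * p) %/ period p), s <- iota 0 (4 * p)].

Lemma mem_near_period_list n p m : m <= n -> near_period p m ->
  m \in near_period_list n p.
Proof.
move=> mn [i [i0 im mi]]; apply/allpairsP.
exists (i, m + 3 * p - i * period p); rewrite !mem_iota /=; split; [|lia|lia].
rewrite i0 add1n ltnS leq_divRL //; first by lia.
by have := period_gt p; lia.
Qed.

Lemma size_near_period_list n p : size (near_period_list n p) * 2 ^ p <= n.
Proof.
rewrite size_allpairs !size_iota.
have := leq_divM (n + 3 * p) (period p).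
set q := _ %/ _; case: (posnP q) => [->//|q0]; rewrite /period.
have e0 : 0 < 2 ^ p by rewrite expn_gt0.
(* Two copies of the wanted quantity appear; one of them, being at least [4 * p], absorbs the
   [3 * p]. *)
have -> : q * (8 * p.+1 * 2 ^ p) = 2 * (q * (4 * p) * 2 ^ p) + 8 * (q * 2 ^ p) by lia.
case: (posnP p) => [->|p0]; first by rewrite !muln0.
have : 4 * p <= q * (4 * p) * 2 ^ p.
  by rewrite mulnAC leq_pmull// muln_gt0 q0.
by lia.
Qed.

Lemma size_near_period_lists n P L :
  size (flatten [seq near_period_list n p | p <- iota P L]) * 2 ^ P <= 2 * n.
Proof.
elim: L P => [|L IH] P /=; first by rewrite mul0n.
rewrite size_cat mulnDl.
by have := size_near_period_list n P; have := IH P.+1; rewrite expnS; lia.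
Qed.

Lemma count_common_height (A : set nat) P N n : 0 < P ->
  (forall m, N <= m -> A m -> 3 * P <= height 0 m /\ 3 * P <= height 1 m) ->
  count_upto A n * 2 ^ P <= N * 2 ^ P + 2 * n.
Proof.
move=> P0 hA.
apply: (@leq_trans ((N + size (flatten [seq near_period_list n p | p <- iota P n.+1])) * 2 ^ P)).
  rewrite leq_mul2r; apply/orP; right.
  rewrite -[X in X + _](size_iota 0 N) -size_cat; apply: count_upto_le => m mn Am.
  rewrite mem_cat mem_iota add0n; case: ltnP => // Nm; apply/orP; right.
  have [h0 h1] := hA m Nm Am.
  have [|p Pp np] := @common_height m _ _ h0 h1; first by lia.
  apply/flattenP; exists (near_period_list n p); last exact: mem_near_period_list.
  (* Since [period p] exceeds [8 * p], a window meeting [[0, n]] has [p <= n]. *)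
  apply: map_f; rewrite mem_iota; case: np => -[|i] [// i0 im _].
  by have := period_gt p; rewrite mulSn in im; lia.
by rewrite mulnDl leq_add2l size_near_period_lists.
Qed.

(** * Visit times: separation and lower density *)

(* The set [E_p]. *)
Definition visit (e p n : nat) : Prop :=
  exists k i, [/\ 0 < k, logn 2 k = p, i * period p < scale e k & n = scale e k + i * period p].

(** In different blocks, [n] lies below a fiftieth of the scale of the block of [m], so [m - n] is
    comparable to that scale. *)
Lemma visit_lt e p q n m : visit e p n -> visit e q m -> n < m ->
  (p = q /\ exists2 i, 0 < i & m = n + i * period p) \/
  (exists k, [/\ 0 < k, p <= k, q <= k, scale e k <= 2 * (m - n) & m < 2 * scale e k]).
Proof.
move=> [k [i [k0 kp ik ->]]] [l [j [l0 lq jl ->]]] nm.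
have := ltn_logl 2 k0; have := ltn_logl 2 l0; rewrite kp lq => ql pk.
case: (ltngtP k l) => [kl|lk|kl].
- by right; exists l; have := scale_lt e kl; split; lia.
- by have := scale_lt e lk; have := scale_gt e l0; lia.
- have pq : p = q by rewrite -kp -lq kl.
  left; split => //; rewrite -kl -pq in nm *.
  have ij : i < j by move: nm; rewrite ltn_add2l ltn_mul2r => /andP[].
  by exists (j - i); [lia|rewrite -addnA -mulnDl subnKC // ltnW].
Qed.

Lemma visit_uniq e p q n : visit e p n -> visit e q n -> p = q.
Proof.
move=> [k [i [k0 <- ik nE]]] [l [j [l0 <- jl mE]]]; congr logn.
case: (ltngtP k l) => // [kl|lk].
  by have := scale_lt e kl; lia.
by have := scale_lt e lk; lia.
Qed.

(** The gap after a visit exceeds the [p] coordinates written there, so copies of targets never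
    overlap. *)
Lemma visit_inj e p q n m t u : visit e p n -> visit e q m -> t < p -> u < q ->
  n + t = m + u -> p = q /\ t = u.
Proof.
wlog nm : p q n m t u / n <= m => [H vn vm tp uq E|vn vm tp uq E].
  case: (leqP n m) => [|/ltnW] nm; first exact: H vn vm tp uq E.
  by have [] := H _ _ _ _ _ _ nm vm vn uq tp (esym E).
have [nm'|mn] := ltnP n m.
  exfalso; case: (visit_lt vn vm nm') => [[pq [[|i]//_ mE]]|[k [k0 pk _ km _]]].
    by have := period_gt p; rewrite mulSn in mE; lia.
  by have := scale_gt e k0; lia.
have {nm mn} nm : n = m by lia.
by rewrite -nm in vm; split; [exact: visit_uniq vn vm|lia].
Qed.

Lemma visit_required e p n t : visit e p n -> t < p ->
  exists k, [/\ p <= k, n + t <= 3 * scale e k & required e (n + t) (4 * k)].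
Proof.
move=> [k [i [k0 kp ik ->]]] tp.
have := ltn_logl 2 k0; rewrite kp => pk; have := scale_gt e k0.
by exists k; split; [lia|lia|left; exists k; split => //; lia].
Qed.

Lemma bracket (f : nat -> nat) n : f 0 <= n -> (forall m, m < f m) ->
  exists u, f u <= n < f u.+1.
Proof.
move=> f0 fm; have ex : exists u, n < f u.+1 by exists n; exact: leq_trans (fm n.+1).
case: (ex_minnP ex) => -[|u] nu min_u; [by exists 0; rewrite f0|exists u.+1].
by rewrite nu andbT leqNgt; apply/negP => /min_u; rewrite ltnn.
Qed.

Lemma visit_density e p : exists c N, 0 < c /\ forall (A : set nat),
  (forall n, visit e p n -> A n) -> forall n, N <= n -> n.+1 <= c * count_upto A n.
Proof.
(* The numbers of 2-adic valuation [p]: consecutive ones differ by [2 ^ p.+1], so their scales have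
   a bounded ratio. *)
pose k u := 2 ^ p * (2 * u + 1).
have k_gt u : u < k u by rewrite /k; have : 0 < 2 ^ p by [rewrite expn_gt0]; nia.
have k_log u : logn 2 (k u) = p.
  rewrite /k lognM ?expn_gt0 ?addn1 // pfactorK // logn_coprime ?addn0 //.
  by rewrite coprime2n /= mul2n odd_double.
have kS u : k u.+1 = 2 ^ p.+1 + k u by rewrite /k expnS; lia.
(* For [n] between the ends of two consecutive blocks: a block ends at twice its scale, the next
   scale is [10 ^ (2 * 2 ^ p.+1)] times larger, and one point in [period p] is a visit. *)
pose c := 2 * 10 ^ (2 * 2 ^ p.+1) * period p.
have p0 : 0 < period p by have := period_gt p; lia.
exists c, (2 * scale e (k 0)); split; first by rewrite /c muln_gt0 p0 muln_gt0 expn_gt0.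
move=> A vA n kn.
have [||u /andP[un nu]] := @bracket (fun u => 2 * scale e (k u)) n; first by [].
  by move=> m; have := k_gt m; have : 0 < k m by [apply: leq_ltn_trans (k_gt m)];
    move=> /(scale_gt e); lia.
have ku0 : 0 < k u by apply: leq_ltn_trans (k_gt u).
set b := scale e (k u) in un.
have b0 : 0 < b by rewrite expn_gt0.
have nb : n.+1 <= 2 * (10 ^ (2 * 2 ^ p.+1) * b).
  by rewrite /b /scale -expnD addnA -mulnDr -kS.
have cnt : ((b.-1) %/ period p).+1 <= count_upto A n.
  pose s := [seq b + i * period p | i <- iota 0 (b.-1 %/ period p).+1].
  have <- : size s = (b.-1 %/ period p).+1 by rewrite size_map size_iota.
  apply: count_upto_ge.
    rewrite map_inj_uniq ?iota_uniq // => i j /addnI /eqP.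
    by rewrite eqn_pmul2r // => /eqP.
  move=> _ /mapP[i + ->]; rewrite mem_iota /= add0n ltnS leq_divRL // => ib.
  split; first lia.
  by apply: vA; exists (k u), i; split => //; rewrite -/b; lia.
have bp : b <= period p * count_upto A n.
  rewrite -(prednK b0) (leq_trans (ltn_ceil b.-1 p0)) // mulnC leq_mul2l.
  by rewrite cnt orbT.
by rewrite (leq_trans nb) // /c -mulnA -mulnA !leq_mul.
Qed.

Lemma injective_unbounded (f : nat -> nat) : injective f -> forall N, exists j, N <= f j.
Proof.
move=> fi N; apply: contrapT => no.
have := @uniq_leq_size _ [seq f j | j <- iota 0 N.+1] (iota 0 N).
rewrite map_inj_uniq // iota_uniq size_map !size_iota ltnn => /(_ isT) h.
suff: false by []; apply: h => _ /mapP[j _ ->].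
by rewrite mem_iota /= add0n ltnNge; apply/negP => Nj; apply: no; exists j.
Qed.

Local Open Scope classical_set_scope.
Local Open Scope ring_scope.

(** * The weights and the iterates of the shift *)

Section WeightedShift.
Variable R : realType.
Implicit Types (x y : nat -> R) (e m n p q t : nat).

Lemma c0P x : c0 x <-> forall eps : R, 0 < eps ->
  exists N, forall n, (N <= n)%N -> `|x n| < eps.
Proof.
split=> [/cvgr0Pnorm_lt h eps /h [N _ hN]|h]; first by exists N.
by apply/cvgr0Pnorm_lt => eps /h[N hN]; exists N.
Qed.

Lemma c0_finite x N : (forall n, (N <= n)%N -> x n = 0) -> c0 x.
Proof. by move=> xN; apply/c0P => eps e0; exists N => n /xN ->; rewrite normr0. Qed.

Lemma pow2_small (eps : R) : 0 < eps -> exists N, forall n, (N <= n)%N -> (2^-1) ^+ n < eps.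
Proof.
move=> e0; exists (Num.bound eps^-1) => n /upper_nthrootP.
by rewrite exprVn => h; rewrite invf_plt ?posrE ?exprn_gt0.
Qed.

Definition weight_prod e n : R := 2 ^+ height e n.

Definition weight e n : R := weight_prod e n / weight_prod e n.-1.

Lemma weight_prod_gt0 e n : 0 < weight_prod e n.
Proof. exact: exprn_gt0. Qed.

Lemma weight_prod_neq0 e n : weight_prod e n != 0.
Proof. by rewrite gt_eqF ?weight_prod_gt0. Qed.

Lemma weight_prod0 e : weight_prod e 0 = 1.
Proof. by rewrite /weight_prod height0. Qed.

Lemma weight_bounded e : bounded_weight (weight e).
Proof.
exists 2 => n; rewrite /weight gtr0_norm ?divr_gt0 ?weight_prod_gt0 //.
rewrite ler_pdivrMr ?weight_prod_gt0 // -exprS ler_weXn2l ?ler1n //.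
by case: n => [|n]; [rewrite height0|exact: heightS].
Qed.

Lemma iter_bshift e n x l :
  iter n (bshift (weight e)) x l = weight_prod e (n + l) / weight_prod e l * x (n + l)%N.
Proof.
elim: n l => [|n IH] l; first by rewrite add0n divff ?mul1r ?weight_prod_neq0.
rewrite /= {1}/bshift IH /weight /= addnS addSn.
by have := weight_prod_neq0 e l; have := weight_prod_neq0 e l.+1 => *; field; apply/andP.
Qed.

Lemma bshift_c0 w x : bounded_weight w -> c0 x -> c0 (bshift w x).
Proof.
move=> [M wM] /c0P cx; apply/c0P => eps e0.
have M0 : 0 < `|M| + 1 by rewrite ltr_wpDl.
have [N hN] := cx _ (divr_gt0 e0 M0); exists N => n Nn.
have := hN n.+1 (leqW Nn); rewrite ltr_pdivlMr // => /le_lt_trans; apply.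
rewrite /bshift normrM mulrC ler_wpM2l // (le_trans (wM _)) //.
by rewrite (le_trans (ler_norm _)) // lerDl.
Qed.

Lemma iter_bshift_c0 w x n : bounded_weight w -> c0 x -> c0 (iter n (bshift w) x).
Proof. by move=> bw cx; elim: n => // n IH; exact: bshift_c0. Qed.

(** * A dense family of targets *)

(* Each finite rational sequence [s] is a target for infinitely many [p], namely the
   codes of [(s, j)]; the test on [s] keeps targets bounded in terms of [p]. *)
Definition target_seq p : seq rat :=
  if (unpickle p : option (seq rat * nat)) is Some (s, _) then
    if (size s <= p)%N && all (fun a => `|a| <= 2 ^+ p) s then s else [::]
  else [::].

Definition target p t : R := ratr (target_seq p)`_t.

Lemma target_seqP p :
  (size (target_seq p) <= p)%N /\ all (fun a => `|a| <= 2 ^+ p) (target_seq p).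
Proof. by rewrite /target_seq; case: unpickle => [[s j]|] //; case: ifP => [/andP|]. Qed.

Lemma target_out p t : (p <= t)%N -> target p t = 0.
Proof.
move=> pt; rewrite /target nth_default ?rmorph0 //.
exact: leq_trans (target_seqP p).1 pt.
Qed.

Lemma target_le p t : `|target p t| <= 2 ^+ p.
Proof.
rewrite /target; case: (ltnP t (size (target_seq p))) => ts; last first.
  by rewrite nth_default ?rmorph0 ?normr0 // exprn_ge0.
have /allP/(_ _ (mem_nth 0 ts)) := (target_seqP p).2.
by rewrite -(ler_rat R) ratr_norm rmorphXn /= ratr_nat.
Qed.

Lemma target_dense y (eps : R) : c0 y -> 0 < eps ->
  exists p, (2^-1) ^+ p < eps /\ forall t, `|y t - target p t| < eps.
Proof.
move=> /c0P cy e0.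
have [N yN] := cy _ e0.
have /choice[r yr] : forall t, exists a : rat, `|y t - ratr a| < eps.
  move=> t; have [|a] := @rat_in_itvoo R (y t - eps) (y t + eps).
    by rewrite ltrD2l gtrN.
  by rewrite in_itv /= => ?; exists a; rewrite distrC ltr_distl.
pose s := mkseq r N.
have [B sB] : exists B, forall p, (B <= p)%N -> all (fun a => `|a| <= 2 ^+ p) s.
  elim: s => [|a s [B sB]]; first by exists 0%N.
  exists (maxn (Num.bound `|a|) B) => p; rewrite geq_max => /andP[/upper_nthrootP ap /sB sp].
  by rewrite /= ltW.
have [K hK] := pow2_small e0.
(* As [j] is free, [p] can be large enough for the error bound and for both tests in
   [target_seq]. *)
have [|j] := @injective_unbounded (fun j => pickle (s, j)) _ (maxn N (maxn B K)).
  by move=> i j /(pcan_inj (@pickleK _)) [].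
rewrite !geq_max => /and3P[Np Bp Kp].
exists (pickle (s, j)); split; first exact: hK.
move=> t; rewrite /target /target_seq pickleK size_mkseq Np sB //=.
case: (ltnP t N) => tN; first by rewrite nth_mkseq.
by rewrite nth_default ?size_mkseq // rmorph0 subr0 yN.
Qed.

(** * The frequently hypercyclic vector *)

Definition located e m (qt : nat * nat) : Prop :=
  (qt.2 < qt.1)%N /\ exists2 n, visit e qt.1 n & m = (n + qt.2)%N.

(* The default (0, 0) of [xget] is harmless since [target 0] vanishes. *)
Definition numerator e m : R :=
  let qt := xget (0%N, 0%N) [set qt | located e m qt] in
  weight_prod e qt.2 * target qt.1 qt.2.

Definition universal e m : R := numerator e m / weight_prod e m.

Lemma numerator_visit e p n t : visit e p n -> (t < p)%N ->
  numerator e (n + t) = weight_prod e t * target p t.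
Proof.
move=> vn tp; rewrite /numerator; case: xgetP => [[q u] _ [/= uq [m vm nm]]|no].
  by have [-> ->] := visit_inj vn vm tp uq nm.
by exfalso; apply: (no (p, t)); split => //; exists n.
Qed.

Lemma numerator_le e m : numerator e m = 0 \/
  exists q t n, [/\ visit e q n, (t < q)%N, m = (n + t)%N & `|numerator e m| <= 2 ^+ (2 * q)].
Proof.
rewrite /numerator; case: xgetP => [[q u] _ [/= uq [n vn ->]]|_]; last first.
  by left; rewrite target_out ?mulr0.
right; exists q, u, n; split => //.
rewrite normrM mul2n -addnn exprD ler_pM ?target_le //.
rewrite gtr0_norm ?weight_prod_gt0 // ler_weXn2l ?ler1n //.
by rewrite (leq_trans (height_le _ _)) // ltnW.
Qed.

Lemma div_weight_prod_le e (a : R) l i j : `|a| <= 2 ^+ i -> (i + j <= height e l)%N ->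
  `|a / weight_prod e l| <= (2^-1) ^+ j.
Proof.
move=> ai ij; rewrite normrM normfV (ger0_norm (ltW (weight_prod_gt0 _ _))).
rewrite ler_pdivrMr ?weight_prod_gt0 // (le_trans ai) //.
by rewrite exprVn ler_pdivlMl ?exprn_gt0 // -exprD ler_weXn2l ?ler1n // addnC.
Qed.

(** In block [k] the numerator is at most [2 ^+ (2 * q)] with [q <= k], against a height of at least
    [4 * k]. *)
Lemma universal_c0 e : c0 (universal e).
Proof.
apply/c0P => eps e0; have [K hK] := pow2_small e0; exists (3 * scale e K).+1 => m mK.
rewrite /universal; case: (numerator_le e m) => [->|].
  by rewrite mul0r normr0.
move=> [q [t [n [vn tq mE le_m]]]].
have [k [qk nk /required_le_height]] := visit_required vn tq.
rewrite -mE in nk * => hm.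
have Kk : (K <= k)%N by rewrite leqNgt; apply/negP => /ltnW/(leq_scale e); lia.
apply: le_lt_trans (hK k Kk).
by apply: div_weight_prod_le le_m _; lia.
Qed.

(** Coordinates below [p] match exactly. A later one may meet a copy of target [q]; the height at
    [l] must then reach [2 * q + p], which the required [3 * p] (when [q = p]) or [4 * k] (when
    [p, q <= k]) supplies. *)
Lemma universal_visit e p n l : visit e p n ->
  `|iter n (bshift (weight e)) (universal e) l - target p l| <= (2^-1) ^+ p.
Proof.
move=> vn.
have -> : iter n (bshift (weight e)) (universal e) l = numerator e (n + l) / weight_prod e l.
  rewrite iter_bshift /universal.
  by have := weight_prod_neq0 e l; have := weight_prod_neq0 e (n + l) => *; field; apply/andP.
case: (ltnP l p) => lp.
  rewrite (numerator_visit vn lp) mulrC mulKf ?weight_prod_neq0 //.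
  by rewrite subrr normr0 exprn_ge0 ?invr_ge0.
rewrite target_out // subr0; case: (numerator_le e (n + l)) => [->|].
  by rewrite mul0r normr0 exprn_ge0 ?invr_ge0.
move=> [q [t [m [vm tq nm le_m]]]]; apply: div_weight_prod_le le_m _.
have [mn|mn|mn] := ltngtP m n.
(* An earlier copy ends before time [n]. *)
- case: (visit_lt vm vn mn) => [[pq [[|i] //_ nE]]|[k [k0 qk pk kn _]]].
    by have := period_gt q; rewrite mulSn in nE; lia.
  by have := scale_gt e k0; lia.
- case: (visit_lt vn vm mn) => [[pq [i i0 mE]]|[k [k0 pk qk kn mk]]].
    rewrite (_ : 2 * q + p = 3 * p)%N; last lia.
    apply: required_le_height; right; exists p, i.
    have -> : l = (i * period p + t)%N by lia.
    by split; lia.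
  have := scale_gt e k0 => ?.
  apply: (@leq_trans (4 * k)); first lia.
  by apply: required_le_height; left; exists k; split; lia.
- by rewrite mn in vm; have := visit_uniq vm vn; lia.
Qed.

Lemma bshift_freq_hypercyclic e : freq_hypercyclic (bshift (weight e)).
Proof.
exists (universal e); first exact: universal_c0.
move=> V oV [y cy Vy]; have [eps e0 ballV] := oV y cy Vy.
have [p [pe yp]] := target_dense cy (divr_gt0 e0 (ltr0n R 3)).
have [c [N [c0 hc]]] := visit_density e p.
exists c%:R^-1; first by rewrite invr_gt0 ltr0n.
exists N => n Nn; rewrite ler_pdivrMl ?ltr0n // -natrM ler_nat.
apply: hc Nn => m vm; apply: ballV.
  exact: iter_bshift_c0 (weight_bounded e) (universal_c0 e).
exists (eps / 3 + (2^-1) ^+ p); split; first by lra.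
move=> t; rewrite -[y t](subrK (target p t)) -addrA (le_trans (ler_normD _ _)) //.
by apply: lerD; [exact: ltW|rewrite distrC; exact: universal_visit].
Qed.

(** * Failure for the direct sum *)

Lemma iter_bshift_large e x n (c : nat) : `|x n| < (2^-1) ^+ c ->
  1 < `|iter n (bshift (weight e)) x 0%N| -> (c <= height e n)%N.
Proof.
move=> xn; rewrite iter_bshift addn0 weight_prod0 divr1 normrM.
rewrite gtr0_norm ?weight_prod_gt0 // leqNgt => lt1; apply/negP => hc.
have : weight_prod e n * `|x n| <= 2 ^+ c * (2^-1) ^+ c.
  by rewrite ler_pM ?(ltW (weight_prod_gt0 _ _)) ?(ltW xn) // ler_weXn2l ?ler1n // ltnW.
by rewrite exprVn divff ?expf_neq0 ?pnatr_eq0 // leNgt lt1.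
Qed.

Lemma iter_pair (T T' : (nat -> R) -> (nat -> R)) n x x' :
  iter n (fun z => (T z.1, T' z.2)) (x, x') = (iter n T x, iter n T' x').
Proof. by elim: n => //= n ->. Qed.

Lemma bshift2_not_ufreq : ~ ufreq_hypercyclic2 (bshift (weight 0)) (bshift (weight 1)).
Proof.
move=> [x [x' [/c0P cx /c0P cx' H]]].
pose V : set ((nat -> R) * (nat -> R)) := [set z | 1 < `|z.1 0%N| /\ 1 < `|z.2 0%N|].
have [||d d0 hd] := H V.
- move=> y y' _ _ [/= y1 y1']; exists (Num.min (`|y 0%N| - 1) (`|y' 0%N| - 1)).
    by rewrite lt_min !subr_gt0 y1.
  move=> z z' _ _ [r [+ hr]] [r' [+ hr']]; rewrite !lt_min => /andP[ry _] /andP[_ ry'].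
  have := hr 0%N; have := hr' 0%N.
  have := lerB_dist (y 0%N) (z 0%N); have := lerB_dist (y' 0%N) (z' 0%N).
  by move=> *; rewrite /V /=; split; lra.
- pose y : nat -> R := fun n => if n is 0%N then 2 else 0.
  have cy : c0 y by apply: (@c0_finite _ 1) => -[].
  by exists y, y; split => //; rewrite /V /= ger0_norm ?ltr1n.
(* The successor makes the exponent positive, as [count_common_height] asks. *)
have [Q /(_ Q.+1 (leqnSn _)) hQ] := pow2_small (divr_gt0 d0 (ltr0n R 4)).
have [|N xN] := cx ((2^-1) ^+ (3 * Q.+1)); first by rewrite exprn_gt0 ?invr_gt0.
have [|N' xN'] := cx' ((2^-1) ^+ (3 * Q.+1)); first by rewrite exprn_gt0 ?invr_gt0.
set M := maxn N N'.
(* For such [n] the [M] initial times contribute at most [n], which leaves [3 * n] against more than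
   [4 * n.+1]. *)
have [n Mn dn] := hd (M * 2 ^ Q.+1)%N.
have : (count_upto (return_set (fun z => (bshift (weight 0) z.1, bshift (weight 1) z.2))
    (x, x') V) n * 2 ^ Q.+1 <= M * 2 ^ Q.+1 + 2 * n)%N.
  apply: count_common_height => // m; rewrite geq_max => /andP[Nm Nm'].
  rewrite /return_set /= iter_pair => -[/= large large'].
  by split; [exact: iter_bshift_large (xN _ Nm) large|exact: iter_bshift_large (xN' _ Nm') large'].
move/leq_trans/(_ (leq_add Mn (leqnn _))); rewrite -(ler_nat R) natrM => up.
have q0 : 0 < (2 ^ Q.+1)%:R :> R by rewrite ltr0n expn_gt0.
have hq : 4 < d * (2 ^ Q.+1)%:R.
  by move: hQ; rewrite exprVn natrX ltr_pdivlMr // mulrC ltr_pdivrMr ?exprn_gt0.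
have := ler_wpM2r (ltW q0) dn; rewrite mulrAC => /le_trans/(_ up).
have := ler_wpM2r (ler0n R n.+1) (ltW hq).
move=> /le_trans h /h; rewrite natrD natrM -natr1.
by have := ler0n R n; lra.
Qed.

End WeightedShift.

Theorem theorem4p2 (R : realType) :
  exists w w' : nat -> R,
    [/\ bounded_weight w, bounded_weight w',
        freq_hypercyclic (bshift w), freq_hypercyclic (bshift w')
      & ~ ufreq_hypercyclic2 (bshift w) (bshift w')].
Proof.
exists (@weight R 0), (@weight R 1).
split; [exact: weight_bounded|exact: weight_bounded| | |exact: bshift2_not_ufreq];
  exact: bshift_freq_hypercyclic.
Qed.
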